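(* Assume \textsf{ZFC} together with the hypothesis that $0^{\#}$ exists. Then there is a countable structure $\mathcal A$ (in a countable language with computable arity function) such that \[ Sp(\mathcal A)=Sp(\mathcal A'). \]
   Context: All languages are at most countable, relational, with a computable arity function. $\Sigma^{c}_n$ denotes the class of computably infinitary $\Sigma_n$ formulas (in the sense of Ash). For a language $L$, fix a computable enumeration $\{\varphi_i:i\in\omega\}$ of all computably infinitary $\Sigma_1$ $L$-formulas. For an $L$-structure $\mathcal A$, its jump $\mathcal A'$ is the structure obtained from $\mathcal A$ by adding, for each $i\in\omega$, a new relation $K_i$ of the same arity as the number of free variables of $\varphi_i$, interpreted by $\mathcal A'\models K_i(\bar x)\iff \mathcal A\models\varphi_i(\bar x)$. The degree spectrum $Sp(\mathcal A)$ of a countable structure $\mathcal A$ is the set of Turing degrees that compute (the atomic diagram of) a copy of $\mathcal A$, i.e. of a structure isomorphic to $\mathcal A$ whose domain is a subset of $\omega$. *)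

(* Defs.v *)
From Stdlib Require Import Arith List Cantor.
Import ListNotations.

Notation "⟨ x , y ⟩" := (Cantor.to_nat (x, y)) (at level 0, format "⟨ x ,  y ⟩").

(** Programs for unary partial functions on [nat]; several arguments are
    passed through the Cantor pairing. *)
Inductive prog : Type :=
| PZero
| PSucc
| PLeft
| PRight
| POracle
| PPair (f g : prog)
| PComp (f g : prog)
| PRec (f g : prog)
| PMu (f : prog).

Inductive eval (O : nat -> Prop) : prog -> nat -> nat -> Prop :=
| eval_zero x : eval O PZero x 0
| eval_succ x : eval O PSucc x (S x)
| eval_left x y : eval O PLeft ⟨x, y⟩ x
| eval_right x y : eval O PRight ⟨x, y⟩ y
| eval_oracle_in x : O x -> eval O POracle x 1
| eval_oracle_out x : ~ O x -> eval O POracle x 0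
| eval_pair f g x a b :
    eval O f x a -> eval O g x b -> eval O (PPair f g) x ⟨a, b⟩
| eval_comp f g x y z :
    eval O g x y -> eval O f y z -> eval O (PComp f g) x z
| eval_rec_0 f g a y :
    eval O f a y -> eval O (PRec f g) ⟨a, 0⟩ y
| eval_rec_S f g a n y z :
    eval O (PRec f g) ⟨a, n⟩ y ->
    eval O g ⟨a, ⟨n, y⟩⟩ z ->
    eval O (PRec f g) ⟨a, S n⟩ z
| eval_mu f a n (w : nat -> nat) :
    (forall k, k < n -> eval O f ⟨a, k⟩ (S (w k))) ->
    eval O f ⟨a, n⟩ 0 ->
    eval O (PMu f) a n.

Definition turing_le (X Y : nat -> Prop) : Prop :=
  exists p, forall x, (X x -> eval Y p x 1) /\ (~ X x -> eval Y p x 0).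

Definition turing_equiv (X Y : nat -> Prop) : Prop :=
  turing_le X Y /\ turing_le Y X.

Definition turing_degree : Type :=
  { C : (nat -> Prop) -> Prop | exists X, forall Y, C Y <-> turing_equiv Y X }.

Definition no_oracle : nat -> Prop := fun _ => False.

Definition computable_set (X : nat -> Prop) : Prop := turing_le X no_oracle.

Definition computable_fun (f : nat -> nat) : Prop :=
  exists p, forall x, eval no_oracle p x (f x).

Fixpoint prog_code (p : prog) : nat :=
  match p with
  | PZero => ⟨0, 0⟩
  | PSucc => ⟨1, 0⟩
  | PLeft => ⟨2, 0⟩
  | PRight => ⟨3, 0⟩
  | POracle => ⟨4, 0⟩
  | PPair f g => ⟨5, ⟨prog_code f, prog_code g⟩⟩
  | PComp f g => ⟨6, ⟨prog_code f, prog_code g⟩⟩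
  | PRec f g => ⟨7, ⟨prog_code f, prog_code g⟩⟩
  | PMu f => ⟨8, prog_code f⟩
  end.

(** The [e]-th computably enumerable set; it is empty when [e] is not the code
    of a program. *)
Definition W (e x : nat) : Prop :=
  exists p y, prog_code p = e /\ eval no_oracle p x y.

(** The symbols are the members of a set of natural numbers; [arity] is
    meaningful on that set only. *)
Record language : Type := Language {
  symbol : nat -> Prop;
  arity : nat -> nat
}.

Definition computable_language (L : language) : Prop :=
  computable_set (symbol L) /\ computable_fun (arity L).

(** [rel s xs] matters only if [s] is a symbol of [L] and [xs] has length
    [arity L s]; every definition below ignores its other values. *)
Record structure (L : language) : Type := Structure {
  carrier :> Type;
  rel : nat -> list carrier -> Prop
}.
Arguments Structure {L} carrier rel.
Arguments carrier {L} _.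
Arguments rel {L} _ _ _.

Definition isomorphic {L : language} (A B : structure L) : Prop :=
  exists (f : A -> B) (g : B -> A),
    (forall a, g (f a) = a) /\ (forall b, f (g b) = b) /\
    forall s xs, symbol L s -> length xs = arity L s ->
      (rel A s xs <-> rel B s (map f xs)).

Definition countable (X : Type) : Prop :=
  exists f : X -> nat, forall x y, f x = f y -> x = y.

Inductive qf : Type :=
| QEq (x y : nat)
| QRel (s : nat) (xs : list nat)
| QNot (p : qf)
| QAnd (p q : qf)
| QOr (p q : qf).

Fixpoint qf_wf (L : language) (p : qf) : Prop :=
  match p with
  | QEq _ _ => True
  | QRel s xs => symbol L s /\ length xs = arity L s
  | QNot p => qf_wf L p
  | QAnd p q | QOr p q => qf_wf L p /\ qf_wf L q
  end.

Fixpoint qf_vars (p : qf) : list nat :=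
  match p with
  | QEq x y => [x; y]
  | QRel _ xs => xs
  | QNot p => qf_vars p
  | QAnd p q | QOr p q => qf_vars p ++ qf_vars q
  end.

Fixpoint qf_sat {L : language} (A : structure L) (v : nat -> A) (p : qf) : Prop :=
  match p with
  | QEq x y => v x = v y
  | QRel s xs => rel A s (map v xs)
  | QNot p => ~ qf_sat A v p
  | QAnd p q => qf_sat A v p /\ qf_sat A v q
  | QOr p q => qf_sat A v p \/ qf_sat A v q
  end.

Definition literal (p : qf) : Prop :=
  match p with
  | QEq _ _ | QRel _ _ | QNot (QEq _ _) | QNot (QRel _ _) => True
  | _ => False
  end.

Fixpoint list_code (xs : list nat) : nat :=
  match xs with
  | [] => 0
  | x :: xs => S ⟨x, list_code xs⟩
  end.

Fixpoint qf_code (p : qf) : nat :=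
  match p with
  | QEq x y => ⟨0, ⟨x, y⟩⟩
  | QRel s xs => ⟨1, ⟨s, list_code xs⟩⟩
  | QNot p => ⟨2, qf_code p⟩
  | QAnd p q => ⟨3, ⟨qf_code p, qf_code q⟩⟩
  | QOr p q => ⟨4, ⟨qf_code p, qf_code q⟩⟩
  end.

(** A formula in the free variables [0, ..., nfree - 1]: the disjunction, over
    the quantifier-free [L]-formulas [p] whose code is in [W disjuncts], of
    [∃ ȳ p], where [ȳ] lists the variables of [p] that are [>= nfree].
    Members of [W disjuncts] that do not code an [L]-formula are ignored. *)
Record sigma1 : Type := Sigma1 {
  nfree : nat;
  disjuncts : nat
}.

Definition sigma1_sat {L : language} (A : structure L) (phi : sigma1)
    (xs : list A) : Prop :=
  exists p, W (disjuncts phi) (qf_code p) /\ qf_wf L p /\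
    exists v : nat -> A, map v (seq 0 (nfree phi)) = xs /\ qf_sat A v p.

Definition sigma1_enum (i : nat) : sigma1 :=
  Sigma1 (fst (Cantor.of_nat i)) (snd (Cantor.of_nat i)).

(** The symbol [s] of [L] becomes [2 * s], and the new symbol [K_i] is
    [2 * i + 1]. *)
Definition jump_language (L : language) : language :=
  Language
    (fun s => if Nat.even s then symbol L (Nat.div2 s) else True)
    (fun s => if Nat.even s then arity L (Nat.div2 s)
              else nfree (sigma1_enum (Nat.div2 s))).

Definition jump {L : language} (A : structure L) : structure (jump_language L) :=
  @Structure (jump_language L) (carrier A)
    (fun s xs => if Nat.even s then rel A (Nat.div2 s) xs
                 else sigma1_sat A (sigma1_enum (Nat.div2 s)) xs).

Definition nat_structure (L : language) (D : nat -> Prop)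
    (R : nat -> list {x : nat | D x} -> Prop) : structure L :=
  Structure {x : nat | D x} R.

(** The variable [k] is used as the name of the element [k] of the domain. *)
Definition atomic_diagram (L : language) (D : nat -> Prop)
    (R : nat -> list {x : nat | D x} -> Prop) (z : nat) : Prop :=
  exists p, z = qf_code p /\ qf_wf L p /\ literal p /\
    exists v : nat -> {x : nat | D x},
      (forall k, In k (qf_vars p) -> proj1_sig (v k) = k) /\
      qf_sat (nat_structure L D R) v p.

Definition Sp {L : language} (A : structure L) (d : turing_degree) : Prop :=
  exists X, proj1_sig d X /\
    exists D R, isomorphic A (nat_structure L D R) /\
      turing_le (atomic_diagram L D R) X.

(** De Bruijn indices: [FAll] binds variable [0]. *)
Inductive fml : Type :=
| FMem (x y : nat)
| FEq (x y : nat)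
| FNot (p : fml)
| FAnd (p q : fml)
| FAll (p : fml).

Fixpoint free_below (n : nat) (p : fml) : Prop :=
  match p with
  | FMem x y | FEq x y => x < n /\ y < n
  | FNot p => free_below n p
  | FAnd p q => free_below n p /\ free_below n q
  | FAll p => free_below (S n) p
  end.

Definition scons {M : Type} (a : M) (v : nat -> M) (k : nat) : M :=
  match k with
  | 0 => a
  | S k => v k
  end.

(** Equality is a parameter because sets are represented up to [Veq]. *)
Fixpoint fsat {M : Type} (eqM memM : M -> M -> Prop) (v : nat -> M) (p : fml)
    : Prop :=
  match p with
  | FMem x y => memM (v x) (v y)
  | FEq x y => eqM (v x) (v y)
  | FNot p => ~ fsat eqM memM v p
  | FAnd p q => fsat eqM memM v p /\ fsat eqM memM v q
  | FAll p => forall a, fsat eqM memM (scons a v) p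
  end.

(** Aczel's sets: [sup A f] is the set [{f a | a : A}]. *)
Inductive V : Type := sup (A : Type) (f : A -> V).

Definition index (x : V) : Type := let (A, _) := x in A.
Definition elt (x : V) : index x -> V :=
  match x with sup A f => f end.

Fixpoint Veq (x y : V) : Prop :=
  match x, y with
  | sup A f, sup B g =>
      (forall a, exists b, Veq (f a) (g b)) /\
      (forall b, exists a, Veq (f a) (g b))
  end.

Definition Vmem (x y : V) : Prop := exists i : index y, Veq x (elt y i).

Definition Vsat (X : V) (v : nat -> index X) (p : fml) : Prop :=
  fsat (fun i j => Veq (elt X i) (elt X j))
       (fun i j => Vmem (elt X i) (elt X j)) v p.

(** The set of the subsets of [X] definable over [(X, ∈)] with parameters:
    variable [0] is the element under test and variable [k + 1] the [k]-th
    parameter of the list. Variables beyond the list also denote the element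
    under test, so that no valuation is needed when [X] is empty. *)
Definition Def (X : V) : V :=
  sup (fml * list (index X))
      (fun q => sup {i : index X | Vsat X (fun k => nth k (i :: snd q) i) (fst q)}
                    (fun i => elt X (proj1_sig i))).

(** [L_x] is the union of the [Def L_y] for [y ∈ x]; for [x] an ordinal this is
    the constructible hierarchy. *)
Fixpoint constructible (x : V) : V :=
  match x with
  | sup A f =>
      sup {a : A & index (Def (constructible (f a)))}
          (fun q => elt (Def (constructible (f (projT1 q)))) (projT2 q))
  end.

(** Used only where foundation holds, so well-ordering by membership is
    automatic. *)
Definition is_ord {M : Type} (memM : M -> M -> Prop) (x : M) : Prop :=
  (forall y z, memM y x -> memM z y -> memM z x) /\
  (forall y z w, memM y x -> memM z y -> memM w z -> memM w y).

Definition limit_ordinal (x : V) : Prop :=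
  is_ord Vmem x /\ (exists y, Vmem y x) /\
  forall y, Vmem y x -> exists z, Vmem z x /\ Vmem y z.

Definition limit_ordinal_above_omega (x : V) : Prop :=
  limit_ordinal x /\ exists y, Vmem y x /\ limit_ordinal y.

Definition elem_equiv_L {M : Type} (E : M -> M -> Prop) (gamma : V) : Prop :=
  forall p, free_below 0 p ->
    forall (v : nat -> M) (w : nat -> index (constructible gamma)),
      fsat eq E v p <-> Vsat (constructible gamma) w p.

(** [v 0 < ... < v (n - 1)] in [I]. *)
Definition increasing_in {M : Type} (E : M -> M -> Prop) (I : M -> Prop)
    (n : nat) (v : nat -> M) : Prop :=
  (forall k, k < n -> I (v k)) /\ (forall j k, j < k < n -> E (v j) (v k)).

Definition infinite_pred {M : Type} (I : M -> Prop) : Prop :=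
  exists f : nat -> M, (forall n, I (f n)) /\ forall m n, f m = f n -> m = n.

Definition indiscernibles {M : Type} (E : M -> M -> Prop) (I : M -> Prop) : Prop :=
  (forall x, I x -> is_ord E x) /\
  forall n p v w,
    free_below n p -> increasing_in E I n v -> increasing_in E I n w ->
    (fsat eq E v p <-> fsat eq E w p).

(** For an infinite set of indiscernibles, "some increasing tuple" is the same as
    "every increasing tuple". *)
Definition EM_theory {M : Type} (E : M -> M -> Prop) (I : M -> Prop) (p : fml)
    : Prop :=
  exists n v, free_below n p /\ increasing_in E I n v /\ fsat eq E v p.

(** The elements of [M] definable from parameters in [X]. Over a model of
    [V = L] this is the Skolem hull of [X]. *)
Definition hull {M : Type} (E : M -> M -> Prop) (X : M -> Prop) (a : M) : Prop :=
  exists n p v, free_below (S n) p /\ (forall k, k < n -> X (v k)) /\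
    forall b, fsat eq E (scons b v) p <-> b = a.

Definition well_ordered_in {M : Type} (E : M -> M -> Prop) (I : M -> Prop) : Prop :=
  forall S : M -> Prop, (forall x, S x -> I x) -> (exists x, S x) ->
    exists x, S x /\ forall y, S y -> y = x \/ E x y.

Definition no_greatest {M : Type} (E : M -> M -> Prop) (I : M -> Prop) : Prop :=
  forall x, I x -> exists y, I y /\ E x y.

(** [e] lists increasingly the elements of [I] below [i]; that is, [i] is the
    [omega]-th element of [I]. *)
Definition omega_th {M : Type} (E : M -> M -> Prop) (I : M -> Prop)
    (e : nat -> M) (i : M) : Prop :=
  I i /\ (forall n, E (e n) (e (S n))) /\
  forall j, (I j /\ E j i) <-> exists n, j = e n.

Definition unbounded_in_ord {M : Type} (E : M -> M -> Prop) (I : M -> Prop) : Prop :=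
  forall x, is_ord E x -> exists i, I i /\ E x i.

(** Ehrenfeucht-Mostowski sets as in Jech, "Set Theory", chapter 18; [0^#] is
    by definition the well-founded remarkable one. *)
Definition EM_set (Sigma : fml -> Prop) : Prop :=
  exists (M : Type) (E : M -> M -> Prop) (I : M -> Prop) (gamma : V),
    limit_ordinal_above_omega gamma /\ elem_equiv_L E gamma /\
    infinite_pred I /\ indiscernibles E I /\
    forall p, Sigma p <-> EM_theory E I p.

(** [(M, E)] is a [(Sigma, alpha)]-model with indiscernibles [I], where the
    infinite ordinal [alpha] is the order type of [I]. *)
Definition Sigma_model (Sigma : fml -> Prop)
    (M : Type) (E : M -> M -> Prop) (I : M -> Prop) : Prop :=
  infinite_pred I /\ indiscernibles E I /\ well_ordered_in E I /\
  (forall p, Sigma p <-> EM_theory E I p) /\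
  forall a, hull E I a.

Definition well_founded_EM (Sigma : fml -> Prop) : Prop :=
  forall M E I, Sigma_model Sigma M E I -> well_founded E.

(** Limit order types [alpha > omega] are those of an [I] without greatest
    element that has an [omega]-th element. *)
Definition remarkable_EM (Sigma : fml -> Prop) : Prop :=
  forall M E I e i, Sigma_model Sigma M E I -> no_greatest E I ->
    omega_th E I e i ->
    unbounded_in_ord E I /\
    forall x, is_ord E x -> E x i -> hull E (fun y => exists n, y = e n) x.

Definition zero_sharp_exists : Prop :=
  exists Sigma, EM_set Sigma /\ well_founded_EM Sigma /\ remarkable_EM Sigma.

(* Main.v *)
(** The language has a binary relation [<] and, for each [i], a relation
    [K_i(c, xs)] meaning that the substructure below [c] satisfies the [i]-th
    computable infinitary Sigma_1 formula at [xs]. On a well-founded transitive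
    order such relations exist by recursion on [c]. If a structure [A] for
    which the [K_i] have their intended meaning is isomorphic to its own
    initial segment below some [c], then from any copy of [A] one computes the
    segment below [c] together with its jump, which is a copy of [A'].

    On a well-founded order no such [c] exists, so [A] is only locally like
    one. The back-and-forth types of countable
    sequences below an element, of ranks given by small well-founded trees, form
    a small type, so a sufficiently wide tree order has elements [c < d] with
    the same type of every rank. A decreasing-rank argument then turns this
    into an infinite back-and-forth construction in which each single stage,
    but not the whole run, is realized in the tree order. The limit has an
    isomorphism between what lies below [d] and what lies below [c]. *)

Require Import Defs.
From Stdlib Require Import Arith List Cantor Lia Classical ClassicalEpsilon
  FunctionalExtensionality PropExtensionality.
Import ListNotations.

#[local] Arguments Cantor.to_nat : simpl never.

(** * Computability relative to an oracle *)

Definition pi1 (x : nat) : nat := fst (Cantor.of_nat x).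
Definition pi2 (x : nat) : nat := snd (Cantor.of_nat x).

Lemma pi1_pair x y : pi1 ⟨x, y⟩ = x.
Proof. unfold pi1. now rewrite Cantor.cancel_of_to. Qed.

Lemma pi2_pair x y : pi2 ⟨x, y⟩ = y.
Proof. unfold pi2. now rewrite Cantor.cancel_of_to. Qed.

Lemma pair_pi x : ⟨pi1 x, pi2 x⟩ = x.
Proof. unfold pi1, pi2. rewrite <- surjective_pairing. apply Cantor.cancel_to_of. Qed.

Lemma pair_inj x y x' y' : ⟨x, y⟩ = ⟨x', y'⟩ -> x = x' /\ y = y'.
Proof. intros H. apply Cantor.to_nat_inj in H. now inversion H. Qed.

Definition computes (O : nat -> Prop) (f : nat -> nat) : Prop :=
  exists p, forall x, eval O p x (f x).

Section Computes.
Variable O : nat -> Prop.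

Lemma computes_ext f g : computes O f -> (forall x, f x = g x) -> computes O g.
Proof. intros [p H] E. exists p. intros x. rewrite <- E. apply H. Qed.

Lemma computes_comp f g :
  computes O f -> computes O g -> computes O (fun x => f (g x)).
Proof. intros [p Hp] [q Hq]. exists (PComp p q). intros x. econstructor; eauto. Qed.

Lemma computes_pair f g :
  computes O f -> computes O g -> computes O (fun x => ⟨f x, g x⟩).
Proof. intros [p Hp] [q Hq]. exists (PPair p q). intros x. constructor; auto. Qed.

Lemma computes_pi1 f : computes O f -> computes O (fun x => pi1 (f x)).
Proof.
  apply (computes_comp pi1). exists PLeft. intros x.
  rewrite <- (pair_pi x) at 1. constructor.
Qed.

Lemma computes_pi2 f : computes O f -> computes O (fun x => pi2 (f x)).
Proof.
  apply (computes_comp pi2). exists PRight. intros x.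
  rewrite <- (pair_pi x) at 1. constructor.
Qed.

Lemma computes_id : computes O (fun x => x).
Proof.
  exists (PPair PLeft PRight). intros x. rewrite <- (pair_pi x). repeat constructor.
Qed.

Lemma computes_S f : computes O f -> computes O (fun x => S (f x)).
Proof. apply (computes_comp S). exists PSucc. constructor. Qed.

Lemma computes_const n : computes O (fun _ => n).
Proof.
  induction n as [|n IH].
  - exists PZero. constructor.
  - now apply computes_S.
Qed.

Lemma computes_rec f g n :
  computes O f ->
  computes O (fun w => g (pi1 w) (pi1 (pi2 w)) (pi2 (pi2 w))) ->
  computes O n ->
  computes O (fun x => nat_rect (fun _ => nat) (f x) (g x) (n x)).
Proof.
  intros [p Hp] [q Hq] Hn.
  apply (computes_ext (fun x => nat_rect (fun _ => nat) (f (pi1 ⟨x, n x⟩))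
                                 (g (pi1 ⟨x, n x⟩)) (pi2 ⟨x, n x⟩))).
  2: { intros x. now rewrite pi1_pair, pi2_pair. }
  refine (computes_comp (fun w => nat_rect _ (f (pi1 w)) (g (pi1 w)) (pi2 w)) _ _
            (computes_pair _ _ computes_id Hn)).
  exists (PRec p q). intros w. rewrite <- (pair_pi w) at 1.
  generalize (pi1 w) (pi2 w). intros a m. induction m as [|m IH]; simpl.
  - now constructor.
  - econstructor; [exact IH|].
    specialize (Hq ⟨a, ⟨m, nat_rect (fun _ => nat) (f a) (g a) m⟩⟩).
    now repeat (rewrite pi1_pair in Hq || rewrite pi2_pair in Hq).
Qed.

Lemma computes_case f g h :
  computes O f -> computes O g -> computes O (fun w => h (pi1 w) (pi2 w)) ->
  computes O (fun x => match f x with 0 => g x | S m => h x m end).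
Proof.
  intros Hf Hg Hh.
  apply (computes_ext (fun x => nat_rect (fun _ => nat) (g x) (fun m _ => h x m) (f x))).
  2: { intros x. now destruct (f x). }
  apply (computes_rec g (fun x m _ => h x m)); trivial.
  apply (computes_ext (fun w => h (pi1 ⟨pi1 w, pi1 (pi2 w)⟩) (pi2 ⟨pi1 w, pi1 (pi2 w)⟩))).
  2: { intros x. now rewrite pi1_pair, pi2_pair. }
  apply (computes_comp (fun w => h (pi1 w) (pi2 w)) _ Hh).
  auto using computes_pair, computes_pi1, computes_pi2, computes_id.
Qed.

End Computes.

Ltac computes :=
  repeat first
    [ assumption
    | match goal with
      | H : computes ?O ?f |- computes ?O (fun x => ?f (@?g x)) =>
          apply (computes_comp O f g H)
      | H : forall f, computes ?O f -> computes ?O (fun x => ?F (f x))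
        |- computes ?O (fun x => ?F (@?g x)) => apply (H g)
      end
    | apply computes_const
    | apply computes_id
    | apply computes_pair
    | apply computes_pi1
    | apply computes_pi2
    | apply computes_case
    | apply computes_S
    | progress cbv beta ].

Lemma computes_add O f g :
  computes O f -> computes O g -> computes O (fun x => f x + g x).
Proof.
  intros Hf Hg.
  apply (computes_ext O (fun x => nat_rect (fun _ => nat) (g x) (fun _ y => S y) (f x))).
  - apply (computes_rec O g (fun _ _ y => S y)); computes.
  - intros x. induction (f x); simpl; congruence.
Qed.

Definition parity (n : nat) : nat := if Nat.even n then 0 else 1.

(** Both values are carried through one primitive recursion: a successor flips the parity and raises
    the half only when it leaves an odd number. *)
Lemma computes_parity_div2 O f :
  computes O f -> computes O (fun x => ⟨parity (f x), Nat.div2 (f x)⟩).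
Proof.
  intros Hf.
  apply (computes_ext O (fun x => nat_rect (fun _ => nat) ⟨0, 0⟩
    (fun _ y => match pi1 y with 0 => ⟨1, pi2 y⟩ | S _ => ⟨0, S (pi2 y)⟩ end) (f x))).
  - apply (computes_rec O (fun _ => ⟨0, 0⟩)
      (fun _ _ y => match pi1 y with 0 => ⟨1, pi2 y⟩ | S _ => ⟨0, S (pi2 y)⟩ end));
      computes.
  - intros x. induction (f x) as [|n IH]; [reflexivity|].
    cbn [nat_rect]. rewrite IH, pi1_pair, pi2_pair. clear IH. unfold parity.
    rewrite Nat.even_succ, <- Nat.negb_even.
    destruct (Nat.even n) eqn:E; simpl negb; cbv beta iota; f_equal; f_equal.
    + apply Nat.even_spec in E as [m ->].
      rewrite Nat.div2_succ_double, Nat.div2_double. reflexivity.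
    + assert (Nat.odd n = true) as E' by (now rewrite <- Nat.negb_even, E).
      apply Nat.odd_spec in E' as [m ->].
      replace (S (2 * m + 1)) with (2 * (S m)) by lia.
      rewrite Nat.div2_double, Nat.add_1_r, Nat.div2_succ_double. reflexivity.
Qed.

Lemma computes_parity O f : computes O f -> computes O (fun x => parity (f x)).
Proof.
  intros Hf. apply (computes_ext O (fun x => pi1 ⟨parity (f x), Nat.div2 (f x)⟩)).
  - now apply computes_pi1, computes_parity_div2.
  - intros x. apply pi1_pair.
Qed.

Lemma computes_div2 O f : computes O f -> computes O (fun x => Nat.div2 (f x)).
Proof.
  intros Hf. apply (computes_ext O (fun x => pi2 ⟨parity (f x), Nat.div2 (f x)⟩)).
  - now apply computes_pi2, computes_parity_div2.
  - intros x. apply pi2_pair.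
Qed.

Definition chi (X : nat -> Prop) (x : nat) : nat :=
  if excluded_middle_informative (X x) then 1 else 0.

Lemma turing_le_chi X Y : turing_le X Y <-> computes Y (chi X).
Proof.
  split; intros [p H]; exists p; intros x; specialize (H x); unfold chi in *;
    destruct (excluded_middle_informative (X x)); tauto.
Qed.

Lemma turing_le_of_computes X Y f :
  computes Y f -> (forall x, X x -> f x = 1) -> (forall x, ~ X x -> f x = 0) ->
  turing_le X Y.
Proof.
  intros Hf H1 H0. apply turing_le_chi, (computes_ext _ _ _ Hf).
  intros x. unfold chi. destruct (excluded_middle_informative (X x)); auto.
Qed.

(** * Codes of lists, formulas and literals *)

Lemma list_code_surj n : exists l, list_code l = n.
Proof.
  induction n as [n IH] using lt_wf_ind. destruct n as [|n].
  - now exists [].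
  - destruct (IH (pi2 n)) as [l Hl].
    + pose proof (Cantor.to_nat_non_decreasing (pi1 n) (pi2 n)) as H.
      rewrite pair_pi in H. lia.
    + exists (pi1 n :: l). simpl. now rewrite Hl, pair_pi.
Qed.

Lemma list_code_inj l l' : list_code l = list_code l' -> l = l'.
Proof.
  revert l'. induction l as [|x l IH]; intros [|y l']; simpl; try discriminate; trivial.
  intros H. apply eq_add_S, pair_inj in H as [-> H]. f_equal. auto.
Qed.

Lemma qf_code_inj p q : qf_code p = qf_code q -> p = q.
Proof.
  revert q. induction p; intros []; simpl; intros H;
    apply pair_inj in H as [E H]; try discriminate E;
    repeat match goal with
    | H : ⟨_, _⟩ = ⟨_, _⟩ |- _ => apply pair_inj in H as [? H]
    | H : list_code _ = list_code _ |- _ => apply list_code_inj in H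
    end; subst; f_equal; auto.
Qed.

(** The state [y] is ⟨flag, remaining list⟩. *)
Definition all_step (q : nat -> nat) (y : nat) : nat :=
  match pi2 y with
  | 0 => y
  | S m => ⟨match q (pi1 m) with 0 => 0 | S _ => pi1 y end, pi2 m⟩
  end.

(** The code [l] doubles as the number of iterations: it bounds the length of the list, and
    [all_step] fixes every state whose remaining list is empty. *)
Definition all_list (q : nat -> nat) (l : nat) : nat :=
  pi1 (nat_rect (fun _ => nat) ⟨1, l⟩ (fun _ => all_step q) l).

Lemma computes_all_list O q f :
  computes O q -> computes O f -> computes O (fun x => all_list q (f x)).
Proof.
  intros Hq Hf. apply computes_pi1.
  apply (computes_rec O (fun x => ⟨1, f x⟩) (fun _ _ y => all_step q y));
    [|unfold all_step|]; computes.
Qed.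

Lemma length_le_list_code l : length l <= list_code l.
Proof.
  induction l as [|x l IH]; simpl; trivial.
  pose proof (Cantor.to_nat_non_decreasing x (list_code l)). lia.
Qed.

Lemma all_list_spec q l :
  all_list q (list_code l) =
  if excluded_middle_informative (forall x, In x l -> q x <> 0) then 1 else 0.
Proof.
  unfold all_list.
  assert (H : forall n l b, length l <= n ->
    nat_rect (fun _ => nat) ⟨b, list_code l⟩ (fun _ => all_step q) n =
    ⟨if excluded_middle_informative (forall x, In x l -> q x <> 0) then b else 0, 0⟩).
  { clear l. intros n l b.
    (* [nat_rect] unfolds at the last step, while the list is consumed from the first;
       [Nat.iter_succ_r] peels off the first. *)
    assert (E : forall y, nat_rect (fun _ => nat) y (fun _ => all_step q) n
                          = Nat.iter n (all_step q) y) by reflexivity.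
    rewrite E. clear E. revert l b.
    induction n as [|n IH]; intros l b Hl; [|rewrite Nat.iter_succ_r].
    - destruct l; [|simpl in Hl; lia]. simpl.
      destruct excluded_middle_informative as [_|n]; trivial.
      destruct n. intros x [].
    - unfold all_step at 2. rewrite pi2_pair.
      destruct l as [|x l]; cbn -[Nat.iter Cantor.to_nat] in *.
      + rewrite (IH []); [|simpl; lia].
        destruct excluded_middle_informative; reflexivity.
      + rewrite !pi1_pair, !pi2_pair. rewrite IH by lia. f_equal. f_equal.
        destruct excluded_middle_informative as [H1|H1];
          destruct excluded_middle_informative as [H2|H2]; trivial.
        * destruct (q x) eqn:Ex; trivial. destruct (H2 x); auto.
        * destruct (q x) eqn:Ex; trivial. destruct H2. intros y [->|Hy]; auto; lia.
        * destruct H1. auto. }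
  rewrite H by apply length_le_list_code. apply pi1_pair.
Qed.

(** [t] acts on the arguments as well as on the symbol, so that an atom [K_i(xs)] can receive an
    extra first argument. Only literals get translated, hence the descent through [QNot] alone. *)
Fixpoint map_rel (t : nat -> list nat -> nat * list nat) (p : qf) : qf :=
  match p with
  | QRel s xs => QRel (fst (t s xs)) (snd (t s xs))
  | QNot p => QNot (map_rel t p)
  | _ => p
  end.

(** The leading tags decide the matter, because every number codes some list of arguments. *)
Lemma literal_code z :
  pi1 z < 2 \/ (pi1 z = 2 /\ pi1 (pi2 z) < 2) <-> exists p, literal p /\ z = qf_code p.
Proof.
  assert (atom : forall z, pi1 z < 2 -> exists p, z = qf_code p /\
                   literal p /\ literal (QNot p)).
  { clear z. intros z Hz. rewrite <- (pair_pi z). destruct (pi1 z) as [|[|]]; [| |lia].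
    - exists (QEq (pi1 (pi2 z)) (pi2 (pi2 z))). simpl. now rewrite pair_pi.
    - destruct (list_code_surj (pi2 (pi2 z))) as [l Hl].
      exists (QRel (pi1 (pi2 z)) l). simpl. now rewrite Hl, pair_pi. }
  split.
  - intros [Hz|[Hz Hz']].
    + destruct (atom z Hz) as (p & ? & ? & _). eauto.
    + destruct (atom _ Hz') as (p & E & _ & ?). exists (QNot p). split; trivial.
      simpl. now rewrite <- E, <- Hz, pair_pi.
  - intros (p & Hp & ->). destruct p as [| |[]| |]; try contradiction;
      simpl; rewrite ?pi1_pair, ?pi2_pair, ?pi1_pair; lia.
Qed.

(** The common reduction between atomic diagrams: [q] is the domain of the copy with diagram [Y],
    and [th] computes on codes the translation [t] into the diagram [Y']. *)
Lemma turing_le_map_rel Y Y' (q : nat -> Prop) t th X :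
  turing_le Y' X -> turing_le q X -> computes X th ->
  (forall s l, th ⟨s, list_code l⟩ = ⟨fst (t s l), list_code (snd (t s l))⟩) ->
  (forall z, Y z -> exists p, literal p /\ z = qf_code p) ->
  (forall p, literal p ->
     Y (qf_code p) <-> (forall k, In k (qf_vars p) -> q k) /\ Y' (qf_code (map_rel t p))) ->
  turing_le Y X.
Proof.
  intros HY' Hq Hth Eth Hlit HY.
  rewrite turing_le_chi in HY', Hq.
  (* [tr] and [vars] expect codes of atoms; [F] first strips a possible negation and rejects every
     number that codes no literal. *)
  set (tr := fun z => match pi1 z with 0 => z | S _ => ⟨1, th (pi2 z)⟩ end).
  set (vars := fun z => match pi1 z with
    | 0 => S ⟨pi1 (pi2 z), S ⟨pi2 (pi2 z), 0⟩⟩ | S _ => pi2 (pi2 z) end).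
  set (dec := fun v z => match all_list (chi q) v with 0 => 0 | S _ => chi Y' z end).
  set (F := fun z =>
    match pi1 z with
    | 0 | 1 => dec (vars z) (tr z)
    | 2 => match pi1 (pi2 z) with
           | 0 | 1 => dec (vars (pi2 z)) ⟨2, tr (pi2 z)⟩
           | _ => 0
           end
    | _ => 0
    end).
  assert (HF : computes X F).
  { pose proof (fun f => computes_all_list X (chi q) f Hq) as Hall.
    unfold F, dec, vars, tr. computes. }
  assert (Edec : forall l z, dec (list_code l) z =
    if excluded_middle_informative ((forall k, In k l -> q k) /\ Y' z) then 1 else 0).
  { intros l z. unfold dec. rewrite all_list_spec.
    assert (E : (forall k, In k l -> chi q k <> 0) <-> (forall k, In k l -> q k)).
    { split; intros H k Hk; specialize (H k Hk); unfold chi in *;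
        destruct (excluded_middle_informative (q k)); (congruence || tauto). }
    apply propositional_extensionality in E. rewrite E. unfold chi.
    repeat destruct excluded_middle_informative; tauto. }
  assert (Eatom : forall p, literal p -> literal (QNot p) ->
    pi1 (qf_code p) < 2 /\ vars (qf_code p) = list_code (qf_vars p) /\
    tr (qf_code p) = qf_code (map_rel t p)).
  { intros [] Hp Hp'; try contradiction; unfold vars, tr; simpl;
      repeat (rewrite pi1_pair || rewrite pi2_pair);
      rewrite ?Eth; repeat split; lia. }
  assert (Elit : forall p, literal p ->
            F (qf_code p) = dec (list_code (qf_vars p)) (qf_code (map_rel t p))).
  { intros p Hp. unfold F.
    assert (C : literal (QNot p) \/ exists p', p = QNot p' /\ literal p').
    { destruct p as [| |[]| |]; simpl in *; eauto; right; eexists; split; eauto; easy. }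
    destruct C as [C|(p' & -> & C)].
    - destruct (Eatom p Hp C) as (E & -> & ->).
      destruct (pi1 (qf_code p)) as [|[|]]; trivial; lia.
    - destruct (Eatom p' C Hp) as (E & Ev & Et). simpl.
      repeat (rewrite pi1_pair || rewrite pi2_pair).
      rewrite Ev, Et. destruct (pi1 (qf_code p')) as [|[|]]; trivial; lia. }
  apply (turing_le_of_computes _ _ F HF).
  - intros z Hz. destruct (Hlit z Hz) as (p & Hp & ->).
    rewrite Elit, Edec by trivial. destruct excluded_middle_informative as [|n]; trivial.
    destruct n. now apply HY.
  - intros z Hz. destruct (classic (exists p, literal p /\ z = qf_code p)) as [(p & Hp & ->)|N].
    + rewrite Elit, Edec by trivial. destruct excluded_middle_informative as [y|]; trivial.
      destruct Hz. now apply HY.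
    + rewrite <- literal_code in N. unfold F.
      destruct (pi1 z) as [|[|[|]]]; try lia.
      destruct (pi1 (pi2 z)) as [|[|]]; trivial; lia.
Qed.

(** * Degree spectra *)

(** No map between the carriers is assumed, so a limit structure can be compared with a stage that
    matches it only on the points named so far. *)
Lemma qf_sat_agree L (A B : structure L) p (v : nat -> A) (w : nat -> B) :
  (forall x y, In x (qf_vars p) -> In y (qf_vars p) -> v x = v y <-> w x = w y) ->
  (forall s xs, incl xs (qf_vars p) -> symbol L s -> length xs = arity L s ->
     rel A s (map v xs) <-> rel B s (map w xs)) ->
  qf_wf L p -> qf_sat A v p <-> qf_sat B w p.
Proof.
  induction p as [x y|s xs|p IH|p IHp q IHq|p IHp q IHq]; simpl; intros Heq Hrel W.
  - apply Heq; auto.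
  - destruct W. apply Hrel; trivial. apply incl_refl.
  - now rewrite IH.
  - rewrite IHp, IHq; try tauto;
      intros; (apply Heq || apply Hrel); auto using in_or_app, incl_appl, incl_appr.
  - rewrite IHp, IHq; try tauto;
      intros; (apply Heq || apply Hrel); auto using in_or_app, incl_appl, incl_appr.
Qed.

Lemma qf_sat_ext L (A : structure L) p (v w : nat -> A) :
  (forall k, v k = w k) -> qf_sat A v p <-> qf_sat A w p.
Proof.
  intros E. assert (v = w) as -> by (now apply functional_extensionality). reflexivity.
Qed.

Lemma qf_sat_embedding L (A B : structure L) (f : A -> B) p (v : nat -> A) :
  (forall x y, f x = f y -> x = y) ->
  (forall s xs, symbol L s -> length xs = arity L s -> rel A s xs <-> rel B s (map f xs)) ->
  qf_wf L p -> qf_sat A v p <-> qf_sat B (fun k => f (v k)) p.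
Proof.
  intros Hinj Hrel. apply qf_sat_agree.
  - intros x y _ _. split; [congruence|apply Hinj].
  - intros s xs _ Hs Hl. rewrite Hrel, map_map; [reflexivity|trivial|now rewrite length_map].
Qed.

(** The atomic diagram of the copy of [A] in which [a] is replaced by [phi a]. *)
Definition named_diagram {L : language} (A : structure L) (phi : A -> nat) (z : nat) : Prop :=
  exists p, z = qf_code p /\ qf_wf L p /\ literal p /\
    exists v : nat -> A, (forall k, In k (qf_vars p) -> phi (v k) = k) /\ qf_sat A v p.

Lemma named_diagram_code L (A : structure L) phi p : literal p ->
  named_diagram A phi (qf_code p) <->
  qf_wf L p /\
    exists v : nat -> A, (forall k, In k (qf_vars p) -> phi (v k) = k) /\ qf_sat A v p.
Proof.
  intros Hp. split.
  - intros (p' & E & W & _ & H). apply qf_code_inj in E as <-. auto.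
  - intros [W H]. exists p. auto.
Qed.

Lemma atomic_diagram_copy L (A : structure L) D R f g :
  (forall a, g (f a) = a) -> (forall b, f (g b) = b) ->
  (forall s xs, symbol L s -> length xs = arity L s ->
     rel A s xs <-> rel (nat_structure L D R) s (map f xs)) ->
  atomic_diagram L D R = named_diagram A (fun a => proj1_sig (f a)).
Proof.
  intros gf fg Hrel. apply functional_extensionality. intros z.
  assert (finj : forall x y, f x = f y -> x = y) by (intros x y E; congruence).
  apply propositional_extensionality.
  split; intros (p & -> & W & Hp & v & Hv & Hsat); exists p; repeat split; trivial.
  - exists (fun k => g (v k)). split.
    + intros k Hk. rewrite fg. auto.
    + apply (qf_sat_embedding _ _ _ f p _ finj Hrel W).
      revert Hsat. apply qf_sat_ext. intros. apply fg.
  - exists (fun k => f (v k)). split; trivial.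
    now apply (qf_sat_embedding _ _ _ f p _ finj Hrel W).
Qed.

(** A copy with domain inside the natural numbers amounts to an injective naming of the elements of
    [A]; the carrier stays fixed and only the names vary. *)
Lemma Sp_iff L (A : structure L) d :
  Sp A d <->
  exists X, proj1_sig d X /\ exists phi : A -> nat,
    (forall x y, phi x = phi y -> x = y) /\ turing_le (named_diagram A phi) X.
Proof.
  split.
  - intros (X & HX & D & R & (f & g & gf & fg & Hrel) & Hle).
    exists X. split; trivial. exists (fun a => proj1_sig (f a)). split.
    + intros x y E. apply eq_sig_hprop in E; [congruence|intros; apply proof_irrelevance].
    + now rewrite <- (atomic_diagram_copy L A D R f g).
  - intros (X & HX & phi & Hinj & Hle). exists X. split; trivial.
    set (D := fun n => exists a, phi a = n).
    set (f := fun a => exist D (phi a) (ex_intro _ a eq_refl)).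
    set (g := fun b : {n | D n} =>
                proj1_sig (constructive_indefinite_description _ (proj2_sig b))).
    assert (Hg : forall b, phi (g b) = proj1_sig b)
      by (intros b; unfold g; now destruct constructive_indefinite_description).
    assert (gf : forall a, g (f a) = a) by (intros a; apply Hinj; now rewrite Hg).
    assert (fg : forall b, f (g b) = b).
    { intros b. apply eq_sig_hprop; [intros; apply proof_irrelevance|]. apply Hg. }
    exists D, (fun s xs => rel A s (map g xs)).
    assert (Hrel : forall s xs, symbol L s -> length xs = arity L s ->
      rel A s xs <-> rel A s (map g (map f xs))).
    { intros s xs _ _. rewrite map_map.
      rewrite (map_ext _ (fun a => a)), map_id by apply gf. reflexivity. }
    split.
    + exists f, g. auto.
    + rewrite (atomic_diagram_copy L A _ _ f g gf fg Hrel). exact Hle.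
Qed.

(** The symbol [s] of [A] is the symbol [s + s] of the jump, so the same naming works. *)
Lemma Sp_jump_sub L (A : structure L) d : Sp (jump A) d -> Sp A d.
Proof.
  rewrite !Sp_iff. intros (X & HX & phi & Hinj & Hle).
  exists X. split; trivial. exists phi. split; trivial.
  apply (turing_le_map_rel _ _ (fun _ => True) (fun s l => (s + s, l))
           (fun w => ⟨pi1 w + pi1 w, pi2 w⟩) X Hle).
  - apply (turing_le_of_computes _ _ (fun _ => 1)); [computes|trivial|tauto].
  - apply computes_pair; [apply computes_add|]; computes.
  - intros s l. now rewrite pi1_pair, pi2_pair.
  - intros z (p & -> & _ & Hp & _). eauto.
  - intros p Hp.
    assert (Hev : forall s, Nat.even (s + s) = true)
      by (intros s; rewrite Nat.even_add; now destruct (Nat.even s)).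
    assert (Hdiv : forall s, Nat.div2 (s + s) = s)
      by (intros s; replace (s + s) with (2 * s) by lia; apply Nat.div2_double).
    rewrite !named_diagram_code by
      (trivial; destruct p as [| |[]| |]; simpl in *; trivial).
    assert (E : let p' := map_rel (fun s l => (s + s, l)) p in
      (qf_wf L p <-> qf_wf (jump_language L) p') /\ qf_vars p' = qf_vars p /\
      forall v : nat -> A, qf_sat A v p <-> qf_sat (jump A) v p').
    { destruct p as [| |[]| |]; simpl in *; try contradiction;
        rewrite ?Hev, ?Hdiv; intuition. }
    destruct E as (E1 & -> & E2). rewrite <- E1.
    split; [intros (? & v & ? & ?)|intros (_ & ? & v & ? & ?)]; repeat split; trivial;
      exists v; rewrite ?E2 in *; auto; now rewrite <- E2.
Qed.

(** * Structures that compute their own truth *)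

(** [0] is the binary relation [<], and [S i] holds at [c :: xs] when
    the structure below [c] satisfies the [i]-th formula at [xs]. *)
Definition tower_language : language :=
  Language (fun _ => True)
    (fun s => match s with 0 => 2 | S i => S (nfree (sigma1_enum i)) end).

Lemma tower_language_computable : computable_language tower_language.
Proof.
  split.
  - apply (turing_le_of_computes _ _ (fun _ => 1)); [computes|trivial|simpl; tauto].
  - apply (computes_ext no_oracle
      (fun s => match s with 0 => 2 | S i => S (pi1 i) end)); [computes|].
    intros []; reflexivity.
Qed.

(** If [phi] names [A], then [phi] after [h] names a copy of the jump. Its domain is read off from
    [<] and [c], old relations are read off unchanged, and [K_i] is read off as [S i] with [c] put
    in front. *)
Lemma Sp_jump_of_self_truth (A : structure tower_language) (c : A) (h : A -> A) :
  (forall x y, h x = h y -> x = y) ->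
  (forall x, rel A 0 [x; c] <-> exists y, x = h y) ->
  (forall s xs, length xs = arity tower_language s -> rel A s xs <-> rel A s (map h xs)) ->
  (forall i xs, length xs = nfree (sigma1_enum i) ->
     rel A (S i) (c :: map h xs) <-> sigma1_sat A (sigma1_enum i) xs) ->
  Sp A = Sp (jump A).
Proof.
  intros hinj himg hrel htruth.
  apply functional_extensionality. intros d. apply propositional_extensionality.
  split; [|apply Sp_jump_sub].
  rewrite !Sp_iff. intros (X & HX & phi & Hinj & Hle).
  exists X. split; trivial. exists (fun a : A => phi (h a)).
  split; [intros x y E; apply hinj, Hinj, E|].
  set (c0 := phi c).
  set (t := fun s l => if Nat.even s then (Nat.div2 s, l) else (S (Nat.div2 s), c0 :: l)).
  assert (Hrange : forall k,
    named_diagram A phi (qf_code (QRel 0 [k; c0])) <-> exists a, phi (h a) = k).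
  { intros k. rewrite named_diagram_code by exact I. simpl. split.
    - intros (_ & v & Hv & Hlt).
      assert (v c0 = c) as Ec by (apply Hinj; apply Hv; auto).
      rewrite Ec in Hlt. apply himg in Hlt as [a Ha].
      exists a. rewrite <- Ha. apply Hv. auto.
    - intros [a <-]. split; [auto|].
      assert (Hlt : rel A 0 [h a; c]) by (apply himg; eauto).
      (* The hypotheses do not exclude [h a = c]; then the two names coincide, and so do the two
         values. *)
      exists (fun n => if n =? phi (h a) then h a else c). split.
      + intros n [<-|[<-|[]]].
        * now rewrite Nat.eqb_refl.
        * now destruct (Nat.eqb_spec c0 (phi (h a))).
      + rewrite Nat.eqb_refl. destruct (Nat.eqb_spec c0 (phi (h a))) as [E|]; trivial.
        rewrite <- (Hinj _ _ E) in Hlt |- *. exact Hlt. }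
  apply (turing_le_map_rel _ _ (fun k => named_diagram A phi (qf_code (QRel 0 [k; c0]))) t
           (fun w => match parity (pi1 w) with
                     | 0 => ⟨Nat.div2 (pi1 w), pi2 w⟩
                     | S _ => ⟨S (Nat.div2 (pi1 w)), S ⟨c0, pi2 w⟩⟩
                     end) X Hle).
  - apply turing_le_chi in Hle. apply turing_le_chi.
    apply (computes_comp X (chi (named_diagram A phi))
             (fun k => ⟨1, ⟨0, S ⟨k, S ⟨c0, 0⟩⟩⟩⟩) Hle). computes.
  - pose proof (computes_parity X). pose proof (computes_div2 X). computes.
  - intros s l. rewrite pi1_pair, pi2_pair. unfold t, parity. now destruct (Nat.even s).
  - intros z (p & -> & _ & Hp & _). eauto.
  - intros p Hp.
    rewrite !named_diagram_code by
      (trivial; destruct p as [| |[]| |]; simpl in *; trivial).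
    set (J := jump_language tower_language).
    (* [v] evaluates [p] in the jump, [v'] evaluates its translation in [A] at the images under [h].
       The one possible new variable is [c0], which [v'] must send to [c]. *)
    set (P := fun p =>
      (qf_wf J p <-> qf_wf tower_language (map_rel t p)) /\
      (qf_wf J p -> forall v v' : nat -> A,
         (forall k, In k (qf_vars p) -> v' k = h (v k)) ->
         (In c0 (qf_vars (map_rel t p)) -> v' c0 = c) ->
         qf_sat (jump A) v p <-> qf_sat A v' (map_rel t p)) /\
      (forall k, In k (qf_vars p) -> In k (qf_vars (map_rel t p))) /\
      (forall k, In k (qf_vars (map_rel t p)) -> In k (qf_vars p) \/ k = c0)).
    assert (E : P p).
    { assert (PEq : forall x y, P (QEq x y)).
      { intros x y. unfold P. simpl. repeat split; auto.
        - intros E. rewrite (H0 x), (H0 y), E; auto.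
        - rewrite (H0 x), (H0 y); auto. }
      assert (PRel : forall s xs, P (QRel s xs)).
      { intros s xs. unfold P, t.
        cbn [map_rel qf_wf qf_sat qf_vars jump rel J jump_language symbol arity].
        destruct (Nat.even s); cbn [fst snd].
        - split; [simpl; tauto|]. split; [|auto]. intros [_ W] v v' Hv _.
          rewrite hrel by now rewrite length_map.
          rewrite map_map, (map_ext_in _ v'); [reflexivity|].
          intros k Hk. symmetry. auto.
        - split; [simpl; intuition|]. split; [|simpl; intuition].
          intros [_ W] v v' Hv Hc. cbn [map]. rewrite Hc by (simpl; auto).
          rewrite <- htruth by now rewrite length_map.
          rewrite map_map, (map_ext_in _ v'); [reflexivity|].
          intros k Hk. symmetry. auto. }
      assert (PNot : forall p, P p -> P (QNot p)).
      { intros p' (P1 & P2 & P3). split; [exact P1|]. split; [|exact P3].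
        intros W v v' Hv Hc. cbn [map_rel qf_sat]. rewrite (P2 W v v' Hv Hc). reflexivity. }
      destruct p as [| |[]| |]; try contradiction; auto. }
    destruct E as (Ewf & Esat & Evars & Evars'). fold J. split.
    + intros (W & v & Hv & Hsat). split.
      { intros k Hk. apply Hrange. eauto. }
      split; [now apply Ewf|].
      (* If [c0] already occurs in [p], injectivity of [phi] makes the two prescriptions agree. *)
      set (v' := fun k => if k =? c0 then c else h (v k)).
      assert (Hv' : forall k, In k (qf_vars p) -> v' k = h (v k)).
      { intros k Hk. unfold v'. destruct (Nat.eqb_spec k c0) as [->|]; trivial.
        apply Hinj. symmetry. now apply Hv. }
      assert (Hc : v' c0 = c) by (unfold v'; now rewrite Nat.eqb_refl).
      exists v'. split; [|now apply (Esat W v v')].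
      intros k Hk. apply Evars' in Hk as [Hk| ->]; [|now rewrite Hc].
      rewrite Hv' by trivial. now apply Hv.
    + intros (Hq & W & v' & Hv' & Hsat).
      apply Ewf in W. split; [trivial|].
      set (v := fun k => epsilon (inhabits c) (fun a => phi (h a) = k)).
      assert (Hv : forall k, In k (qf_vars p) -> phi (h (v k)) = k).
      { intros k Hk. apply (epsilon_spec (inhabits c) (fun a => phi (h a) = k)).
        now apply Hrange, Hq. }
      exists v. split; [trivial|]. apply (Esat W v v'); trivial.
      * intros k Hk. apply Hinj. rewrite Hv by trivial. now apply Hv', Evars.
      * intros Hc. apply Hinj. now apply Hv'.
Qed.

(** * Back-and-forth types in a wide tree *)

Lemma choice_fun (A B : Type) (R : A -> B -> Prop) :
  (forall x, exists y, R x y) -> exists f, forall x, R x (f x).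
Proof.
  intros H. exists (fun x => proj1_sig (constructive_indefinite_description _ (H x))).
  intros x. apply proj2_sig.
Qed.

(** Names for the distinguished element [c], for the elements [a x] below [c] and
    for the elements [b x] below [d]; [d] itself does not enter the limit. *)
Inductive point : Type := PC | PA (x : nat) | PB (x : nat).

(** An atomic type of a family indexed by [X]: which indices name equal elements, and which
    relations hold. *)
Definition desc (X : Type) : Type := ((X -> X -> Prop) * (nat -> list X -> Prop))%type.

(** Suprema are indexed by descriptions: this lets one level refute all the
    descriptions reachable in one step, see [good_step]. *)
Inductive level : Type :=
| LZero
| LSucc (t : level)
| LSup (f : desc point -> level).

(** The possible values of the rank [t] invariant. They are formed from [t] without mention of
    trees, which is what allows [tree] to branch over them. *)
Fixpoint back_forth_type (t : level) : Type :=
  match t with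
  | LZero => desc nat
  | LSucc t => back_forth_type t -> Prop
  | LSup f => forall i, back_forth_type (f i)
  end.

(** The branching is over the back-and-forth types, so that a node can have below
    it an element of each type realized in the tree, its own type included. *)
Inductive tree : Type :=
| Leaf
| Node (f : (forall t, back_forth_type t) -> tree).

Fixpoint tlt (x y : tree) : Prop :=
  match y with
  | Leaf => False
  | Node f => exists u, x = f u \/ tlt x (f u)
  end.

Lemma tlt_trans x y z : tlt x y -> tlt y z -> tlt x z.
Proof.
  intros Hxy. induction z as [|f IH]; simpl; [tauto|].
  intros [u [->|H]]; exists u; auto.
Qed.

Lemma tlt_wf : well_founded tlt.
Proof.
  intros x. induction x as [|f IH]; constructor; simpl; [tauto|].
  intros y [u [->|H]]; [apply IH|]. exact (Acc_inv (IH u) H).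
Qed.

(** * Truth below an element of the tree order *)

Definition tree_structure (K : tree -> nat -> list tree -> Prop) : structure tower_language :=
  @Structure tower_language tree
    (fun s xs =>
       match s, xs with
       | 0, [x; y] => tlt x y
       | S i, c :: xs => K c i xs
       | _, _ => False
       end).

(** This is [sigma1_sat] for the segment below [c], with the segment expressed by bounding the
    valuation rather than by a substructure. *)
Definition sat_below (A : structure tower_language) (lt : A -> A -> Prop)
    (c : A) (i : nat) (xs : list A) : Prop :=
  exists p, W (disjuncts (sigma1_enum i)) (qf_code p) /\ qf_wf tower_language p /\
    exists v : nat -> A, (forall k, lt (v k) c) /\
      map v (seq 0 (nfree (sigma1_enum i))) = xs /\ qf_sat A v p.

(** At stage [c] the truth relations are set to false at first arguments not below [c]; this is
    harmless because valuations in [sat_below] stay below [c]. *)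
Definition tree_truth : tree -> nat -> list tree -> Prop :=
  Fix tlt_wf (fun _ => nat -> list tree -> Prop)
    (fun c rec => sat_below
       (tree_structure (fun e i xs => exists h : tlt e c, rec e h i xs)) tlt c).

Definition trees : structure tower_language := tree_structure tree_truth.

Lemma trees_truth c i xs : rel trees (S i) (c :: xs) <-> sat_below trees tlt c i xs.
Proof.
  simpl. unfold tree_truth at 1. rewrite Fix_eq.
  - fold tree_truth. unfold sat_below.
    split; intros (p & HW & Hwf & v & Hv & Hxs & Hsat); exists p; split; trivial;
      split; trivial; exists v; split; trivial; split; trivial; revert Hsat;
      apply qf_sat_agree; trivial; try (intros; reflexivity);
      intros [|s] [|x ys] _ _ _; simpl; try reflexivity;
      split; intros H; (exact (ex_intro _ (Hv x) H) || (destruct H as [_ H]; exact H)).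
  - intros x f g E.
    assert (f = g) as ->; [|reflexivity].
    apply functional_extensionality_dep. intros y.
    apply functional_extensionality_dep. intros h. apply E.
Qed.

Definition describe {X : Type} (z : X -> tree) : desc X :=
  (fun x y => z x = z y, fun s xs => rel trees s (map z xs)).

Definition valuation (c : tree) (a b : nat -> tree) (v : point) : tree :=
  match v with PC => c | PA x => a x | PB x => b x end.

(** Variables are pairs ⟨stage, n⟩; the [k]-th stage chooses those with first
    component [k]. *)
Definition update (a : nat -> tree) (k : nat) (u : nat -> tree) (x : nat) : tree :=
  if pi1 x =? k then u (pi2 x) else a x.

(** One move plays a whole sequence of elements below [c]. Equality of two values at [LSucc t]
    contains both the forth and the back condition, being an equality of sets of types. *)
Fixpoint back_forth (t : level) (k : nat) (c : tree) (a : nat -> tree) : back_forth_type t :=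
  match t with
  | LZero => describe a
  | LSucc t => fun r => exists u, (forall n, tlt (u n) c) /\ r = back_forth t (S k) c (update a k u)
  | LSup f => fun i => back_forth (f i) k c a
  end.

Definition position (c d : tree) (a b : nat -> tree) : Prop :=
  tlt c d /\ (forall x, tlt (a x) c) /\ (forall x, tlt (b x) d).

(** The positions realizing [i] may depend on the level [t]. *)
Definition good (k : nat) (i : desc point) : Prop :=
  forall t, exists c d a b, position c d a b /\ back_forth t k c a = back_forth t k d b /\
    describe (valuation c a b) = i.

Lemma Leaf_lt (f : (forall t, back_forth_type t) -> tree) : tlt Leaf (Node f).
Proof.
  assert (H : forall x, x = Leaf \/ tlt Leaf x).
  { induction x as [|g IH]; [auto|]. right.
    (* Any branch will do; this one shows that the branching type is inhabited. *)
    exists (fun t => back_forth t 0 Leaf (fun _ => Leaf)).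
    destruct (IH (fun t => back_forth t 0 Leaf (fun _ => Leaf))); auto. }
  destruct (H (Node f)); [discriminate|trivial].
Qed.

(** Below [d] the function [g] puts a tree of each type realized above [Leaf]. Since [d] realizes
    its own type, the branch of [d] at that type is a [c] sharing it. *)
Lemma exists_similar : exists c d, tlt Leaf c /\ tlt c d /\
  forall t, back_forth t 0 c (fun _ => Leaf) = back_forth t 0 d (fun _ => Leaf).
Proof.
  set (F := fun c t => back_forth t 0 c (fun _ => Leaf)).
  set (g := fun u => epsilon (inhabits Leaf) (fun c => tlt Leaf c /\ F c = u)).
  set (d := Node g).
  assert (Hg : tlt Leaf (g (F d)) /\ F (g (F d)) = F d).
  { apply (epsilon_spec (inhabits Leaf) (fun c => tlt Leaf c /\ F c = F d)).
    exists d. split; [apply Leaf_lt|reflexivity]. }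
  exists (g (F d)), d. split; [apply Hg|]. split.
  - exists (F d). auto.
  - intros t. exact (f_equal (fun u => u t) (proj2 Hg)).
Qed.

Lemma good_0 : exists i, good 0 i.
Proof.
  destruct exists_similar as (c & d & Hc & Hd & E).
  exists (describe (valuation c (fun _ => Leaf) (fun _ => Leaf))).
  intros t. exists c, d, (fun _ => Leaf), (fun _ => Leaf).
  repeat split; trivial. intros _. now apply (tlt_trans _ c).
Qed.

Lemma update_lt a k u c :
  (forall x, tlt (a x) c) -> (forall x, tlt (u x) c) -> forall x, tlt (update a k u x) c.
Proof. intros Ha Hu x. unfold update. destruct (pi1 x =? k); auto. Qed.

(** If every eligible [i'] failed at some level [f i'], then all of them would fail
    at [LSup f], contradicting goodness of [i] at level [LSucc (LSup f)]. *)
Lemma good_step k i (P : desc point -> Prop) :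
  good k i ->
  (forall c d a b, position c d a b -> describe (valuation c a b) = i ->
     (exists u, (forall n, tlt (u n) c) /\ forall w, (forall n, tlt (w n) d) ->
        P (describe (valuation c (update a k u) (update b k w)))) \/
     (exists w, (forall n, tlt (w n) d) /\ forall u, (forall n, tlt (u n) c) ->
        P (describe (valuation c (update a k u) (update b k w))))) ->
  exists i', good (S k) i' /\ P i'.
Proof.
  intros Hgood HP. apply NNPP. intros N.
  assert (Hbad : forall i', exists t, P i' ->
    ~ exists c d a b, position c d a b /\ back_forth t (S k) c a = back_forth t (S k) d b /\
        describe (valuation c a b) = i').
  { intros i'. destruct (classic (P i')) as [Hi|]; [|exists LZero; tauto].
    destruct (not_all_ex_not _ _ (fun G : good (S k) i' => N (ex_intro _ i' (conj G Hi))))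
      as [t Ht]. eauto. }
  apply choice_fun in Hbad as [f Hf].
  destruct (Hgood (LSucc (LSup f))) as (c & d & a & b & Hpos & E & Hi).
  assert (Hcontra : forall u w, (forall n, tlt (u n) c) -> (forall n, tlt (w n) d) ->
    back_forth (LSup f) (S k) c (update a k u) = back_forth (LSup f) (S k) d (update b k w) ->
    P (describe (valuation c (update a k u) (update b k w))) -> False).
  { intros u w Hu Hw Euw HPi. apply (Hf _ HPi).
    exists c, d, (update a k u), (update b k w). destruct Hpos as (Hcd & Ha & Hb).
    split; [repeat split; auto using update_lt|]. split; [|reflexivity].
    (* The coordinate of the supremum at the description of this very position is the level chosen
       to refute that description. *)
    exact (f_equal (fun r => r _) Euw). }
  destruct (HP c d a b Hpos Hi) as [(u & Hu & H)|(w & Hw & H)].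
  - assert (Hin : back_forth (LSucc (LSup f)) k d b (back_forth (LSup f) (S k) c (update a k u)))
      by (rewrite <- E; exists u; auto).
    destruct Hin as (w & Hw & Euw). apply (Hcontra u w); auto.
  - assert (Hin : back_forth (LSucc (LSup f)) k c a (back_forth (LSup f) (S k) d (update b k w)))
      by (rewrite E; exists w; auto).
    destruct Hin as (u & Hu & Euw). apply (Hcontra u w); auto.
Qed.

(** * The limit structure *)

Lemma map_transfer (X X' Y Z : Type) (f : X -> Y) (g : X' -> Y) (f' : X -> Z) (g' : X' -> Z) l l' :
  (forall x x', In x l -> In x' l' -> f x = g x' -> f' x = g' x') ->
  map f l = map g l' -> map f' l = map g' l'.
Proof.
  revert l'. induction l as [|x l IH]; intros [|x' l'] H; simpl; try discriminate; trivial.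
  intros E. injection E as E1 E2. f_equal.
  - apply H; simpl; auto.
  - apply IH; trivial. intros; apply H; simpl; auto.
Qed.

(** The even stages add to the range of [a] the values of [b] below [c] and
    witnesses for the formulas true below [c]; the odd stages add [c] and the
    values of [a] to the range of [b]. *)
Definition link (k : nat) (i i' : desc point) : Prop :=
  exists c a b u w,
    describe (valuation c a b) = i /\
    describe (valuation c (update a k u) (update b k w)) = i' /\
    if Nat.even k then
      (forall x, tlt (b x) c -> exists n, u n = b x) /\
      (forall j xs, sat_below trees tlt c j (map a xs) ->
         exists p, W (disjuncts (sigma1_enum j)) (qf_code p) /\ qf_wf tower_language p /\
         exists e, map (fun m => u ⟨e, m⟩) (seq 0 (nfree (sigma1_enum j))) = map a xs /\
           qf_sat trees (fun m => u ⟨e, m⟩) p)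
    else (exists n, w n = c) /\ forall x, exists n, w n = a x.

Lemma link_exists k i : good k i -> exists i', good (S k) i' /\ link k i i'.
Proof.
  intros Hgood. apply (good_step k i _ Hgood).
  intros c d a b (Hcd & Ha & Hb) Hi. destruct (Nat.even k) eqn:Ek.
  - left.
    assert (Hwit : forall e, exists v : nat -> tree, (forall m, tlt (v m) c) /\
      forall j xs, e = ⟨j, list_code xs⟩ -> sat_below trees tlt c j (map a xs) ->
        exists p, W (disjuncts (sigma1_enum j)) (qf_code p) /\ qf_wf tower_language p /\
          map v (seq 0 (nfree (sigma1_enum j))) = map a xs /\ qf_sat trees v p).
    { intros e. destruct (list_code_surj (pi2 e)) as [xs Hxs].
      assert (He : e = ⟨pi1 e, list_code xs⟩) by (now rewrite Hxs, pair_pi).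
      destruct (classic (sat_below trees tlt c (pi1 e) (map a xs)))
        as [(p & HW & Hwf & v & Hv & Hvxs & Hsat)|N];
        [exists v|exists a]; split; trivial; intros j ys E;
        rewrite He in E; apply pair_inj in E as [<- E]; apply list_code_inj in E as <-.
      - intros _. exists p. auto.
      - now intros. }
    apply choice_fun in Hwit as [v Hv].
    (* Row 0 collects the values of [b] below [c], and row [S e] holds witnesses for the formula and
       tuple coded by [e]; [a 0] is a default below [c]. *)
    set (u := fun n => match pi1 n with
                       | 0 => if excluded_middle_informative (tlt (b (pi2 n)) c)
                              then b (pi2 n) else a 0
                       | S e => v e (pi2 n)
                       end).
    exists u. split.
    { intros n. unfold u. destruct (pi1 n); [destruct excluded_middle_informative|];
        trivial. apply Hv. }
    intros w Hw. exists c, a, b, u, w. rewrite Ek. repeat split; trivial.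
    + intros x Hx. exists ⟨0, x⟩. unfold u. rewrite pi1_pair, pi2_pair.
      now destruct excluded_middle_informative.
    + intros j xs Hsat. destruct (Hv ⟨j, list_code xs⟩) as [_ H].
      destruct (H j xs eq_refl Hsat) as (p & HW & Hwf & Hvxs & Hp).
      exists p. split; trivial. split; trivial. exists (S ⟨j, list_code xs⟩).
      assert (E : (fun m => u ⟨S ⟨j, list_code xs⟩, m⟩) = v ⟨j, list_code xs⟩).
      { apply functional_extensionality. intros m. unfold u.
        now rewrite pi1_pair, pi2_pair. }
      now rewrite E.
  - right. exists (fun n => match n with 0 => c | S x => a x end). split.
    { intros [|x]; trivial. now apply (tlt_trans _ c). }
    intros u Hu. exists c, a, b, u, (fun n => match n with 0 => c | S x => a x end).
    rewrite Ek. repeat split; trivial.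
    + now exists 0.
    + intros x. now exists (S x).
Qed.

(** Only descriptions are chained: consecutive links may be witnessed by unrelated positions, so no
    infinite play inside the tree results. *)
Lemma good_sequence : exists I : nat -> desc point,
  forall k, good k (I k) /\ link k (I k) (I (S k)).
Proof.
  destruct good_0 as [i0 H0].
  set (next := fun k i => epsilon (inhabits i) (fun i' => good (S k) i' /\ link k i i')).
  set (I := nat_rect (fun _ => desc point) i0 next).
  assert (Hnext : forall k, good k (I k) -> good (S k) (I (S k)) /\ link k (I k) (I (S k))).
  { intros k Hk. exact (epsilon_spec (inhabits (I k)) _ (link_exists k (I k) Hk)). }
  assert (HI : forall k, good k (I k)) by (induction k; [exact H0|now apply Hnext]).
  exists I. intros k. split; [apply HI|apply Hnext, HI].
Qed.

Definition old (k : nat) (v : point) : Prop :=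
  match v with PC => True | PA x | PB x => pi1 x < k end.

Lemma old_bound vs : exists k, forall v, In v vs -> old k v.
Proof.
  induction vs as [|v vs [k IH]]; [now exists 0|].
  exists (k + S (match v with PC => 0 | PA x | PB x => pi1 x end)).
  intros w [->|Hw]; [destruct w; simpl; trivial; lia|].
  specialize (IH w Hw). destruct w; simpl in *; trivial; lia.
Qed.

Lemma old_le k k' v : k <= k' -> old k v -> old k' v.
Proof. destruct v; simpl; lia. Qed.

(** [z] realizes the part of the limit description [N] fixed before stage [k]. *)
Definition represents (N : desc point) (k : nat) (z : point -> tree) : Prop :=
  (forall v w, old k v -> old k w -> fst N v w <-> z v = z w) /\
  (forall s vs, (forall v, In v vs -> old k v) -> snd N s vs <-> rel trees s (map z vs)).

Lemma valuation_update k c a b u w v : old k v ->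
  valuation c (update a k u) (update b k w) v = valuation c a b v.
Proof.
  destruct v; simpl; trivial; intros H; unfold update;
    destruct (Nat.eqb_spec (pi1 x) k); trivial; lia.
Qed.

Lemma link_old k i i' : link k i i' ->
  (forall v w, old k v -> old k w -> fst i v w <-> fst i' v w) /\
  (forall s vs, (forall v, In v vs -> old k v) -> snd i s vs <-> snd i' s vs).
Proof.
  intros (c & a & b & u & w & <- & <- & _). unfold describe, fst, snd. split.
  - intros v v' Hv Hv'. now rewrite !valuation_update.
  - intros s vs Hvs.
    now rewrite (map_ext_in _ _ vs (fun v Hv => valuation_update k c a b u w v (Hvs v Hv))).
Qed.

(** By [link_old] the value on given points is constant once all of them are old, so holding at some
    such stage is the same as holding at every one. *)
Lemma limit_description (I : nat -> desc point) :
  (forall k, link k (I k) (I (S k))) ->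
  exists N : desc point, forall k z, describe z = I k -> represents N k z.
Proof.
  intros Hlink.
  assert (Hle : forall k k', k <= k' ->
    (forall v w, old k v -> old k w -> fst (I k) v w <-> fst (I k') v w) /\
    (forall s vs, (forall v, In v vs -> old k v) -> snd (I k) s vs <-> snd (I k') s vs)).
  { intros k k' Hk. induction Hk as [|k' Hk [IH1 IH2]]; [split; reflexivity|].
    destruct (link_old _ _ _ (Hlink k')) as [H1 H2]. split.
    - intros v w Hv Hw. rewrite IH1 by trivial. apply H1; now apply (old_le k).
    - intros s vs Hvs. rewrite IH2 by trivial. apply H2.
      intros v Hv. apply (old_le k); auto. }
  exists (fun v w => exists k, old k v /\ old k w /\ fst (I k) v w,
          fun s vs => exists k, (forall v, In v vs -> old k v) /\ snd (I k) s vs).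
  intros k z E.
  assert (E1 : forall v w, (z v = z w) = fst (I k) v w) by now rewrite <- E.
  assert (E2 : forall s vs, rel trees s (map z vs) = snd (I k) s vs) by now rewrite <- E.
  split.
  - intros v w Hv Hw. rewrite E1. cbn [fst].
    split; [|intros H; exists k; auto].
    intros (k' & Hv' & Hw' & H). destruct (Nat.le_ge_cases k k') as [L|L].
    + now apply (proj1 (Hle _ _ L)).
    + now apply (proj1 (Hle _ _ L)) in H.
  - intros s vs Hvs. rewrite E2. cbn [snd].
    split; [|intros H; exists k; auto].
    intros (k' & Hvs' & H). destruct (Nat.le_ge_cases k k') as [L|L].
    + now apply (proj2 (Hle _ _ L)).
    + now apply (proj2 (Hle _ _ L)) in H.
Qed.

(** The first clause keeps [a] and [b] atomically alike. The next two put the values of [b] below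
    [c], and witnesses for what is true there, among the values of [a]; the last two put [c] and the
    values of [a] among those of [b], which therefore exhaust the limit. *)
Lemma generic_limit : exists N : desc point,
  (forall k, exists c d a b, position c d a b /\ describe a = describe b /\
     represents N k (valuation c a b)) /\
  (forall x, snd N 0 [PB x; PC] -> exists y, fst N (PA y) (PB x)) /\
  (forall j xs, snd N (S j) (PC :: map PA xs) ->
     exists p, W (disjuncts (sigma1_enum j)) (qf_code p) /\ qf_wf tower_language p /\
     exists k c a b ys, represents N k (valuation c a b) /\
       (forall x, In x xs -> pi1 x < k) /\ (forall m, pi1 (ys m) < k) /\
       map (fun m => a (ys m)) (seq 0 (nfree (sigma1_enum j))) = map a xs /\
       qf_sat trees (fun m => a (ys m)) p) /\
  (exists y, fst N (PB y) PC) /\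
  (forall x, exists y, fst N (PB y) (PA x)).
Proof.
  destruct good_sequence as [I HI].
  destruct (limit_description I) as [N HN]; [apply HI|].
  exists N.
  assert (Hnew : forall a k u n, update a k u ⟨k, n⟩ = u n).
  { intros a k u n. unfold update. now rewrite pi1_pair, pi2_pair, Nat.eqb_refl. }
  assert (Hold : forall a k u x, pi1 x < k -> update a k u x = a x).
  { intros a k u x Hx. unfold update. destruct (Nat.eqb_spec (pi1 x) k); trivial; lia. }
  assert (Heven : forall k, Nat.even (2 * k) = true) by (intros k; apply Nat.even_even).
  assert (Hodd : forall k, Nat.even (S (2 * k)) = false).
  { intros k. rewrite Nat.even_succ, <- Nat.negb_even, Heven. reflexivity. }
  split; [|split; [|split; [|split]]].
  (* Level [LZero] is enough: equality there is equality of atomic descriptions. *)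
  - intros k. destruct (proj1 (HI k) LZero) as (c & d & a & b & Hpos & E & Hi).
    exists c, d, a, b. auto.
  (* An even stage late enough for [x] to be old. *)
  - intros x Hx. set (k := 2 * S (pi1 x)). assert (Hk : pi1 x < k) by lia.
    destruct (proj2 (HI k)) as (c & a & b & u & w & E & E' & H).
    unfold k in H. rewrite Heven in H. fold k in H. destruct H as [H _].
    apply (HN k) in E. apply (HN (S k)) in E'.
    destruct (H x) as [n Hn].
    + apply (proj2 E 0 [PB x; PC]) in Hx; trivial.
      intros v [<-|[<-|[]]]; simpl; trivial.
    + exists ⟨k, n⟩. apply E'; simpl; rewrite ?pi1_pair, ?Hnew, ?Hold; trivial; lia.
  - intros j xs Hxs. destruct (old_bound (map PA xs)) as [k0 Hk0].
    set (k := 2 * k0).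
    assert (Hk : forall x, In x xs -> pi1 x < k).
    { intros x Hx. apply (in_map PA) in Hx. apply Hk0 in Hx. simpl in Hx. lia. }
    destruct (proj2 (HI k)) as (c & a & b & u & w & E & E' & H).
    unfold k in H. rewrite Heven in H. fold k in H. destruct H as [_ H].
    apply (HN k) in E. apply (HN (S k)) in E'.
    destruct (H j xs) as (p & HW & Hwf & e & Hmap & Hsat).
    + apply trees_truth. apply (proj2 E) in Hxs.
      * simpl in Hxs. now rewrite map_map in Hxs.
      * intros v [<-|Hv]; [exact Logic.I|].
        apply in_map_iff in Hv as (x & <- & Hx). exact (Hk x Hx).
    + exists p. split; trivial. split; trivial.
      exists (S k), c, (update a k u), (update b k w), (fun m => ⟨k, ⟨e, m⟩⟩).
      assert (Efun : (fun m => update a k u ⟨k, ⟨e, m⟩⟩) = (fun m => u ⟨e, m⟩))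
        by (apply functional_extensionality; intros; apply Hnew).
      rewrite Efun. split; [exact E'|]. split.
      { intros x Hx. apply Hk in Hx. lia. }
      split; [intros m; rewrite pi1_pair; lia|]. split; trivial.
      rewrite Hmap. apply map_ext_in. intros x Hx. symmetry. auto.
  - set (k := S (2 * 0)).
    destruct (proj2 (HI k)) as (c & a & b & u & w & E & E' & H).
    unfold k in H. rewrite Hodd in H. fold k in H. destruct H as [[n Hn] _].
    apply (HN (S k)) in E'. exists ⟨k, n⟩.
    apply E'; simpl; rewrite ?pi1_pair, ?Hnew; trivial; lia.
  - intros x. set (k := S (2 * S (pi1 x))). assert (Hk : pi1 x < k) by lia.
    destruct (proj2 (HI k)) as (c & a & b & u & w & E & E' & H).
    unfold k in H. rewrite Hodd in H. fold k in H. destruct H as [_ H].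
    destruct (H x) as [n Hn]. apply (HN (S k)) in E'. exists ⟨k, n⟩.
    apply E'; simpl; rewrite ?pi1_pair, ?Hnew, ?Hold; trivial; lia.
Qed.

(** * The quotient of the limit and its self-embedding *)

Theorem theorem1p4 :
  zero_sharp_exists ->
  exists (L : language) (A : structure L),
    computable_language L /\
    inhabited A /\ countable A /\
    Sp A = Sp (jump A).
Proof.
  intros _. destruct generic_limit as (N & Hreal & HF1 & HF2 & HB1 & HB2).
  set (eqv := fst N) in *.
  (* A claim about finitely many points is checked in a tree position that represents a stage at
     which all of them are old. *)
  assert (Hrefl : forall v, eqv v v).
  { intros v. destruct (old_bound [v]) as [k Hk].
    destruct (Hreal k) as (c & d & a & b & _ & _ & [H _]). apply H; simpl in Hk; auto. }
  assert (Hsym : forall v w, eqv v w -> eqv w v).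
  { intros v w. destruct (old_bound [v; w]) as [k Hk]. simpl in Hk.
    destruct (Hreal k) as (c & d & a & b & _ & _ & [H _]).
    fold eqv in H. rewrite !H by auto. congruence. }
  assert (Htrans : forall v w x, eqv v w -> eqv w x -> eqv v x).
  { intros v w x. destruct (old_bound [v; w; x]) as [k Hk]. simpl in Hk.
    destruct (Hreal k) as (c & d & a & b & _ & _ & [H _]).
    fold eqv in H. rewrite !H by auto. congruence. }
  assert (Hcong : forall s vs ws, Forall2 eqv vs ws -> snd N s vs <-> snd N s ws).
  { intros s vs ws Hvw. destruct (old_bound (vs ++ ws)) as [k Hk].
    destruct (Hreal k) as (c & d & a & b & _ & _ & [H1 H2]). fold eqv in H1.
    rewrite !H2 by (intros; apply Hk, in_app_iff; auto).
    enough (map (valuation c a b) vs = map (valuation c a b) ws) as -> by reflexivity.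
    clear H2. induction Hvw as [|v w vs ws Hvw _ IH]; trivial. simpl. f_equal.
    - apply H1; trivial; apply Hk; simpl; rewrite ?in_app_iff; simpl; auto.
    - apply IH. intros x Hx. apply Hk. simpl. rewrite in_app_iff in *. simpl. tauto. }
  assert (Hcongm : forall X s (f g : X -> point) l, (forall x, In x l -> eqv (f x) (g x)) ->
            snd N s (map f l) <-> snd N s (map g l)).
  { intros X s f g l H. apply Hcong. induction l as [|x l IH]; simpl in *; auto. }
  assert (Hab : (forall x y, eqv (PA x) (PA y) <-> eqv (PB x) (PB y)) /\
                forall s xs, snd N s (map PA xs) <-> snd N s (map PB xs)).
  { split.
    - intros x y. destruct (old_bound [PA x; PB x; PA y; PB y]) as [k Hk]. simpl in Hk.
      destruct (Hreal k) as (c & d & a & b & _ & E & [H _]). fold eqv in H.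
      rewrite !H by auto 7. simpl.
      change (fst (describe a) x y <-> fst (describe b) x y). now rewrite E.
    - intros s xs. destruct (old_bound (map PA xs ++ map PB xs)) as [k Hk].
      destruct (Hreal k) as (c & d & a & b & _ & E & [_ H]).
      rewrite !H by (intros; apply Hk, in_app_iff; auto). rewrite !map_map.
      change (snd (describe a) s xs <-> snd (describe b) s xs). now rewrite E. }
  destruct Hab as [Habe Habr].
  assert (HB : forall v, exists y, eqv (PB y) v) by (intros []; eauto).
  set (R := fun v => epsilon (inhabits 0) (fun y => eqv (PB y) v)).
  assert (HR : forall v, eqv (PB (R v)) v).
  { intros v. exact (epsilon_spec (inhabits 0) (fun y => eqv (PB y) v) (HB v)). }
  (* Equivalent points define the same predicate, so [epsilon] returns the same index. *)
  assert (HRe : forall v w, eqv v w -> R v = R w).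
  { intros v w E. unfold R. f_equal. apply functional_extensionality. intros y.
    apply propositional_extensionality. split; intros; eauto. }
  (* The quotient by [eqv] is realized by canonical representatives. *)
  set (A := @Structure tower_language {x : nat | R (PB x) = x}
              (fun s xs => snd N s (map (fun x => PB (proj1_sig x)) xs))).
  set (el := fun x : A => PB (proj1_sig x)).
  set (cls := fun v => exist (fun x => R (PB x) = x) (R v) (HRe _ _ (HR v)) : A).
  assert (Hel : forall v, eqv (el (cls v)) v) by (intros v; apply HR).
  assert (Hcls : forall v w, eqv v w -> cls v = cls w).
  { intros v w E. apply eq_sig_hprop; [intros; apply proof_irrelevance|]. now apply HRe. }
  assert (Hcls' : forall v w, cls v = cls w -> eqv v w).
  { intros v w E. apply (Htrans _ (el (cls v))); auto. rewrite E. apply Hel. }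
  assert (Hce : forall x, cls (el x) = x).
  { intros x. apply eq_sig_hprop; [intros; apply proof_irrelevance|]. exact (proj2_sig x). }
  (* Every class contains some [PB x]; exchanging [PB x] for [PA x] maps the whole structure onto
     its part below [c]. *)
  set (h := fun x : A => cls (PA (proj1_sig x))).
  assert (Hh : forall y, h (cls (PB y)) = cls (PA y)).
  { intros y. apply Hcls, Habe, Hel. }
  assert (Hhel : forall xs, map PB (map (@proj1_sig _ _) xs) = map el xs)
    by (intros xs; now rewrite map_map).
  assert (Hrel_h : forall s xs, rel A s (map h xs) <-> snd N s (map PA (map (@proj1_sig _ _) xs))).
  { intros s xs. unfold rel, A. rewrite !map_map. apply Hcongm. intros x _. apply Hel. }
  exists tower_language, A. split; [exact tower_language_computable|].
  split; [constructor; exact (cls PC)|].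
  split. { exists (@proj1_sig _ _). intros x y E.
           apply eq_sig_hprop; [intros; apply proof_irrelevance|trivial]. }
  apply (Sp_jump_of_self_truth A (cls PC) h).
  - intros x y E. apply Hcls', Habe in E. rewrite <- (Hce x), <- (Hce y). now apply Hcls.
  - intros x.
    assert (E : rel A 0 [x; cls PC] <-> snd N 0 [el x; PC]).
    { apply Hcong. constructor; [apply Hrefl|]. constructor; [apply Hel|constructor]. }
    rewrite E. split.
    + intros H. destruct (HF1 _ H) as [y Hy]. exists (cls (PB y)).
      rewrite Hh, <- (Hce x). symmetry. now apply Hcls.
    + intros [y ->].
      apply (Hcong 0 [el (h y); PC] [PA (proj1_sig y); PC]);
        [constructor; [apply Hel|constructor; [apply Hrefl|constructor]]|].
      destruct (old_bound [PA (proj1_sig y); PC]) as [k Hk].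
      destruct (Hreal k) as (c & d & a & b & (_ & Ha & _) & _ & [_ H]).
      apply H; [exact Hk|]. exact (Ha _).
  - intros s xs _. rewrite Hrel_h, Habr, Hhel. reflexivity.
  - intros i xs _.
    assert (E : rel A (S i) (cls PC :: map h xs) <->
                snd N (S i) (PC :: map PA (map (@proj1_sig _ _) xs))).
    { unfold rel, A. simpl map. rewrite !map_map. apply Hcong.
      constructor; [apply Hel|]. induction xs; constructor; auto. apply Hel. }
    rewrite E. clear E. split.
    (* The witnesses are among the values of [a]; replacing [PA] by [PB] at the same index pulls the
       valuation back along [h]. *)
    + intros H. destruct (HF2 _ _ H) as
        (p & HW & Hwf & k & c & a & b & ys & [H1 H2] & Hxs & Hys & Hmap & Hsat).
      fold eqv in H1.
      exists p. split; trivial. split; trivial. exists (fun m => cls (PB (ys m))). split.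
      * rewrite <- (map_id xs).
        rewrite (map_ext _ (fun x => cls (PB (proj1_sig x))) (fun x => eq_sym (Hce x))).
        rewrite <- (map_map (@proj1_sig _ _) (fun n => cls (PB n))).
        revert Hmap. apply map_transfer. intros m n _ Hn Em.
        apply Hcls, Habe, H1; auto; [apply Hys|apply Hxs, Hn].
      * refine (proj1 (qf_sat_agree _ trees A p _ _ _ _ Hwf) Hsat).
        -- intros x y _ _. split.
           ++ intros Exy. apply Hcls, Habe, H1; auto; apply Hys.
           ++ intros Exy. apply Hcls', Habe, H1 in Exy; auto; apply Hys.
        -- intros s l _ _ _.
           transitivity (snd N s (map (fun m => PA (ys m)) l)).
           ++ rewrite H2, map_map; [reflexivity|].
              intros v Hv. apply in_map_iff in Hv as (m & <- & _). apply Hys.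
           ++ rewrite <- (map_map ys PA), Habr, map_map. unfold rel, A. rewrite map_map.
              apply Hcongm. intros m _. apply Hsym, Hel.
    + intros (p & HW & Hwf & v & Hv & Hsat).
      (* Only the points for [xs] and for the variables of [p] have to be old; the position still
         sends every other variable below [c], as [sat_below] demands. *)
      destruct (old_bound (map (fun m => PA (proj1_sig (v m))) (qf_vars p) ++
                           map PA (map (@proj1_sig _ _) xs))) as [k Hk].
      destruct (Hreal k) as (c & d & a & b & (_ & Ha & _) & _ & [H1 H2]). fold eqv in H1.
      assert (Hk1 : forall m, In m (qf_vars p) -> old k (PA (proj1_sig (v m)))).
      { intros m Hm. apply Hk, in_app_iff. left. apply in_map_iff. eauto. }
      apply H2.
      { intros w [<-|Hw]; [exact I|]. apply Hk, in_app_iff. auto. }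
      change (rel trees (S i)
        (c :: map (valuation c a b) (map PA (map (@proj1_sig _ _) xs)))).
      apply trees_truth. exists p. split; trivial. split; trivial.
      exists (fun m => a (proj1_sig (v m))). split; [intros; apply Ha|]. split.
      { now rewrite map_map, <- Hv, !map_map. }
      refine (proj1 (qf_sat_agree _ A trees p _ _ _ _ Hwf) Hsat).
      * intros x y Hx Hy.
        change (a (proj1_sig (v x))) with (valuation c a b (PA (proj1_sig (v x)))).
        change (a (proj1_sig (v y))) with (valuation c a b (PA (proj1_sig (v y)))).
        rewrite <- H1, Habe by auto. split; [intros ->; apply Hrefl|].
        intros Exy. rewrite <- (Hce (v x)), <- (Hce (v y)). now apply Hcls.
      * intros s l Hl _ _.
        transitivity (snd N s (map PA (map (fun m => proj1_sig (v m)) l))).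
        -- rewrite Habr. unfold rel, A. rewrite !map_map. reflexivity.
        -- rewrite H2, !map_map; [reflexivity|].
           rewrite map_map. intros w Hw. apply in_map_iff in Hw as (m & <- & Hm). auto.
Qed.
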